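(* Let $\Omega$ be an infinite set, and let $J$ be any set of cardinality $\le\mathrm{card}(\Omega)$. Then $L^{=}_{\mathrm{Equiv}(\Omega)_\wedge,J}$ contains no chains with $>\mathrm{card}(\Omega)$ jumps. Hence for any lower semilattice $A$ embeddable in $\mathrm{Equiv}(\Omega)_\wedge$, the lattice $L^{=}_{A,J}$ contains no chains with $>\mathrm{card}(\Omega)$ jumps. In particular, for any lattice $A$ embeddable in $\mathrm{Equiv}(\Omega)$, the lattice $L^{=}_{A_\wedge,J}$ has no such chains.
   Context: $\mathrm{Equiv}(\Omega)$ is the lattice of equivalence relations on $\Omega$, ordered by inclusion as subsets of $\Omega\times\Omega$. For a lattice $A$, $A_\wedge$ denotes $A$ regarded as a lower semilattice, i.e. with the single binary operation $\wedge$ (meet). For a lower semilattice $A$ and a set $J$, a principal solution set in $A^J$ is a set of the form $S_{v=w}=\{a=(a_j)_{j\in J}\in A^J\mid v(a)=w(a)\}$, where $v$ and $w$ are words formed with $\wedge$ from a $J$-tuple of variables $(t_j)_{j\in J}$ and constants from $A$. A solution set in $A^J$ is the intersection of an arbitrary family of principal solution sets (the empty intersection being $A^J$). $L^{=}_{A,J}$ denotes the complete lattice of all solution sets in $A^J$, ordered by inclusion. A chain is a totally ordered subset. A jump in a totally ordered set $C$ is a pair $x<y$ in $C$ such that no $z\in C$ satisfies $x<z<y$. Embeddings are injective homomorphisms (of lower semilattices or of lattices). *)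

(* Defs.v *)
From HB Require Import structures.
From mathcomp Require Import all_boot all_order.
From mathcomp Require Import boolp classical_sets functions cardinality.
From mathcomp Require Import generic_quotient.

Set Implicit Arguments.
Unset Strict Implicit.
Unset Printing Implicit Defensive.

Import Order.TTheory.

Local Open Scope classical_set_scope.
Local Open Scope card_scope.

(* A relation is a [bool]-valued [rel]; under the classical axioms of [boolp]
   these are exactly the subsets of [Omega * Omega], and two elements of
   [Equiv Omega] are equal iff they have the same graph (lemma [Equiv_ext]). *)
Definition Equiv (Omega : Type) : Type := equiv_rel Omega.

Fact equiv_display : Order.disp_t. Proof. exact: Order.Disp tt tt. Qed.

Section EquivLattice.
Variable Omega : Type.
Implicit Types r s t : Equiv Omega.

Lemma Equiv_ext r s : equiv r =2 equiv s -> r = s.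
Proof.
case: r s => [r cr] [s cs] rs.
have {}rs : r = s by apply/funext => x; apply/funext => y; exact: rs.
rewrite -{}rs in cs *; congr EquivRelPack.
by case: cr cs => r1 r2 r3 [s1 s2 s3]; congr EquivClass; exact: Prop_irrelevance.
Qed.

HB.instance Definition _ := gen_eqMixin (Equiv Omega).
HB.instance Definition _ := gen_choiceMixin (Equiv Omega).

Definition equiv_le r s : bool :=
  `[< subrel (equiv r) (equiv s) >].

Fact equiv_le_refl : reflexive equiv_le.
Proof. by move=> r; apply/asboolP. Qed.

Fact equiv_le_anti : antisymmetric equiv_le.
Proof.
move=> r s /andP[/asboolP rs /asboolP sr]; apply: Equiv_ext => x y.
by apply/idP/idP; [exact: rs|exact: sr].
Qed.

Fact equiv_le_trans : transitive equiv_le.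
Proof.
by move=> s r t /asboolP rs /asboolP st; apply/asboolP => x y /rs /st.
Qed.

HB.instance Definition _ := Order.Le_isPOrder.Build equiv_display (Equiv Omega)
  equiv_le_refl equiv_le_anti equiv_le_trans.

Definition equiv_meet_rel r s : rel Omega :=
  [rel x y | equiv r x y && equiv s x y].

Fact equiv_meet_class r s : equiv_class_of (equiv_meet_rel r s).
Proof.
rewrite /equiv_meet_rel; split=> [x|x y|y x z] /=.
- by rewrite !equiv_refl.
- by rewrite (equiv_sym r) (equiv_sym s).
- move=> /andP[rxy sxy] /andP[ryz syz].
  by rewrite (equiv_trans rxy ryz) (equiv_trans sxy syz).
Qed.

Definition equiv_meet r s : Equiv Omega := EquivRelPack (equiv_meet_class r s).

Definition equiv_join_rel r s : rel Omega :=
  [rel x y | `[< forall t : Equiv Omega, (r <= t)%O -> (s <= t)%O ->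
                 equiv t x y >]].

Fact equiv_join_class r s : equiv_class_of (equiv_join_rel r s).
Proof.
split=> [x|x y|y x z] /=.
- by apply/asboolP => t _ _; exact: equiv_refl.
- apply/idP/idP => /asboolP h; apply/asboolP => t rt st.
    by have := h t rt st; rewrite equiv_sym.
  by have := h t rt st; rewrite equiv_sym.
- move=> /asboolP xy /asboolP yz; apply/asboolP => t rt st.
  exact: equiv_trans (xy t rt st) (yz t rt st).
Qed.

(* The least equivalence relation containing both arguments. *)
Definition equiv_join r s : Equiv Omega := EquivRelPack (equiv_join_class r s).

Fact equiv_meetP r s t :
  (r <= equiv_meet s t)%O = (r <= s)%O && (r <= t)%O.
Proof.
apply/idP/andP => [/asboolP h|[/asboolP rs /asboolP rt]].
  by split; apply/asboolP => x y /h /andP[].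
by apply/asboolP => x y rxy; apply/andP; split; [exact: rs|exact: rt].
Qed.

Fact equiv_joinP r s t :
  (equiv_join r s <= t)%O = (r <= t)%O && (s <= t)%O.
Proof.
apply/idP/andP => [/asboolP h|[rt st]].
  split; apply/asboolP => x y xy; apply: h; apply/asboolP => u.
    by move=> /asboolP ru _; exact: ru.
  by move=> _ /asboolP su; exact: su.
by apply/asboolP => x y /asboolP; exact.
Qed.

HB.instance Definition _ := Order.POrder_MeetJoin_isLattice.Build
  equiv_display (Equiv Omega) equiv_meetP equiv_joinP.

End EquivLattice.

(* Words in the variables [t_j], [j : J], and constants from [A]. *)
Inductive word (A J : Type) : Type :=
| WVar of J
| WConst of A
| WMeet of word A J & word A J.

Section Solutions.
Variables (d : Order.disp_t) (A : meetSemilatticeType d) (J : Type).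

Fixpoint word_eval (w : word A J) (a : J -> A) : A :=
  match w with
  | WVar j => a j
  | WConst c => c
  | WMeet w1 w2 => Order.meet (word_eval w1 a) (word_eval w2 a)
  end.

Definition principal_solution_set (v w : word A J) : set (J -> A) :=
  [set a | word_eval v a = word_eval w a].

Definition is_principal_solution_set (S : set (J -> A)) : Prop :=
  exists v w : word A J, S = principal_solution_set v w.

(* The carrier of the lattice of solution sets, inside [set (J -> A)], which
   MathComp orders by inclusion; [F = set0] yields all of [A^J]. *)
Definition solution_lattice : set (set (J -> A)) :=
  [set S | exists2 F : set (set (J -> A)),
             F `<=` is_principal_solution_set & S = \bigcap_(P in F) P].

End Solutions.
Arguments solution_lattice {d} A J.

Section Chains.
Variables (d : Order.disp_t) (T : porderType d).

Definition chain_in (L C : set T) : Prop :=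
  C `<=` L /\ total_on C (fun x y => (x <= y)%O).

Definition jumps (C : set T) : set (T * T) :=
  [set p | [/\ C p.1, C p.2, (p.1 < p.2)%O &
               ~ exists2 z, C z & (p.1 < z < p.2)%O]].

End Chains.

Definition card_lt (T U : Type) (A : set T) (B : set U) : Prop :=
  A #<= B /\ ~ (B #<= A).

Definition meet_embeddable (d d' : Order.disp_t)
    (A : meetSemilatticeType d) (B : meetSemilatticeType d') : Prop :=
  exists2 f : A -> B, injective f &
    {morph f : x y / Order.meet x y >-> Order.meet x y}.

Definition lattice_embeddable (d d' : Order.disp_t)
    (A : latticeType d) (B : latticeType d') : Prop :=
  exists f : A -> B,
    [/\ injective f, Order.meet_morphism f & Order.join_morphism f].

(* Main.v *)
(** Reading a word at a pair [(x, y)] turns an equation over [Equiv Omega] into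
    equations over the two-element semilattice [bool], so every solution set is
    an intersection of sets taken from a fixed family indexed by two boolean
    words and two points of [Omega].  As [J] injects into the infinite set
    [Omega], that family has at most [card Omega] members.  Given a jump
    [S < T], pick a member of the family that contains [S] but not [T]; along a
    chain, distinct jumps pick distinct members. *)
Require Import Defs.
From mathcomp Require Import all_boot all_order.
From mathcomp Require Import boolp classical_sets functions cardinality.

Set Implicit Arguments.
Unset Strict Implicit.
Unset Printing Implicit Defensive.

Local Open Scope classical_set_scope.
Local Open Scope card_scope.

(** * Comparing cardinals by injections *)

Lemma card_le_injective (T U : Type) (f : T -> U) (A : set T) (B : set U) :
    (forall x, A x -> B (f x)) ->
    (forall x y, A x -> A y -> f x = f y -> x = y) ->
  A #<= B.
Proof.
move=> fAB finj; have fA : f @` A #= A.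
  by apply: inj_card_eq => x y /set_mem Ax /set_mem Ay; exact: finj.
rewrite -(card_le_eql fA); apply: subset_card_le => _ [x Ax <-]; exact: fAB.
Qed.

Lemma card_le_fun (T U : Type) (u0 : U) (A : set T) (B : set U) :
  A #<= B -> exists2 f : T -> U, (forall x, A x -> B (f x)) &
    (forall x y, A x -> A y -> f x = f y -> x = y).
Proof.
(* An empty [U] is excluded by [u0]; a pointed one supplies values off [A]. *)
elim/Ppointed: U => U in u0 B *; first by case: (no u0).
move=> /pcard_leP[f]; exists f => [x|x y /mem_set Ax /mem_set Ay].
  exact: funS.
exact: inj.
Qed.

Lemma card_le_rel (T U : Type) (R : T -> U -> Prop) (A : set T) (B : set U) :
    (forall x, A x -> exists2 y, B y & R x y) ->
    (forall x x' y, A x -> A x' -> R x y -> R x' y -> x = x') ->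
  A #<= B.
Proof.
move=> RAB Rinj; have [->|/set0P[a Aa]] := eqVneq A set0; first exact: card_ge0.
have [u0 _ _] := RAB a Aa.
have /choice[f fP] x : exists y, A x -> B y /\ R x y.
  have [/RAB[y By Rxy]|nAx] := pselect (A x); first by exists y.
  by exists u0.
apply: (@card_le_injective _ _ f) => [x /fP[]//|x y Ax Ay fxy].
have [_ Rx] := fP x Ax; have [_ Ry] := fP y Ay.
by apply: (Rinj x y (f x)) => //; rewrite fxy.
Qed.

(** Zorn's lemma gives a maximal graph [G] of a partial injection from [A] to [B]. It is defined on
    all of [A] or reaches all of [B]; otherwise an unmatched [x] and an unmatched [y] could be
    paired. *)
Lemma card_le_total (T U : Type) (A : set T) (B : set U) :
  A #<= B \/ B #<= A.
Proof.
pose P (G : set (T * U)) := G `<=` A `*` B /\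
  forall p q, G p -> G q -> (p.1 = q.1 <-> p.2 = q.2).
have [|G [[GAB Ginj] Gmax]] := @Zorn_bigcup _ P.
  move=> F FP Ftot; split=> [p [X /FP[XAB _]]|p q [X FX Xp] [Y FY Yq]].
    exact: XAB.
  have [XY|YX] := Ftot _ _ FX FY.
    by apply: (FP _ FY).2 => //; exact: XY.
  by apply: (FP _ FX).2 => //; exact: YX.
have [domG|/existsNP[x /not_implyP[Ax xG]]] :=
    pselect (forall x, A x -> exists y, G (x, y)).
  left; apply: (@card_le_rel _ _ (fun x y => G (x, y))) => [x /domG[y Gxy]|].
    by exists y => //; case: (GAB _ Gxy).
  by move=> x x' y _ _ Gxy Gx'y; apply/(Ginj (x, y) (x', y)).
have [ranG|/existsNP[y /not_implyP[By yG]]] :=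
    pselect (forall y, B y -> exists x, G (x, y)).
  right; apply: (@card_le_rel _ _ (fun y x => G (x, y))) => [y /ranG[z Gzy]|].
    by exists z => //; case: (GAB _ Gzy).
  by move=> y y' z _ _ Gzy Gzy'; apply/(Ginj (z, y) (z, y')).
exfalso; apply: (Gmax (G `|` [set (x, y)])).
  split=> [|sub]; first exact: subsetUl.
  by apply: xG; exists y; apply: sub; right.
split=> [p [/GAB//|->//]|p q [Gp|->] [Gq|->]] //; first exact: Ginj.
  split=> /= e; first by case: xG; exists p.2; rewrite -e; case: (p) Gp.
  by case: yG; exists p.1; rewrite -e; case: (p) Gp.
split=> /= e; first by case: xG; exists q.2; rewrite e; case: (q) Gq.
by case: yG; exists q.1; rewrite e; case: (q) Gq.
Qed.

(** * A pairing function on an infinite set *)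

(* [pp_fun] stands for a partial map [D * D -> D], [D := pp_dom], kept total with
   junk values off the domain; the marked points [a] and [b] are the tags that
   make [D + D] embed into [D]. *)
Record partial_pairing (T : Type) (a b : T) := PartialPairing {
  pp_dom : set T;
  pp_fun : T -> T -> T;
  pp_a : pp_dom a;
  pp_b : pp_dom b;
  pp_closed : forall x y, pp_dom x -> pp_dom y -> pp_dom (pp_fun x y);
  pp_inj : forall x y x' y', pp_fun x y = pp_fun x' y' ->
    pp_dom x -> pp_dom y -> pp_dom x' -> pp_dom y' -> x = x' /\ y = y' }.

(** Extension of partial maps. Junk values off the domain make this only a preorder. *)
Definition pp_le (T : Type) (a b : T) (p q : partial_pairing a b) : bool :=
  `[< pp_dom p `<=` pp_dom q /\
      forall x y, pp_dom p x -> pp_dom p y -> pp_fun p x y = pp_fun q x y >].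

Lemma pp_le_refl (T : Type) (a b : T) (p : partial_pairing a b) : pp_le p p.
Proof. by apply/asboolP; split=> // x. Qed.

(** The union of the domains carries a common extension, since any two members of [F] are
    comparable; [p0] bounds the empty chain. *)
Lemma pp_chain_bounded (T : Type) (a b : T) (p0 : partial_pairing a b)
    (F : set (partial_pairing a b)) :
  total_on F (@pp_le T a b) -> exists q, forall p, F p -> pp_le p q.
Proof.
move=> Ftot; have [[p1 Fp1]|F0] := pselect (exists p, F p); last first.
  by exists p0 => p Fp; case: F0; exists p.
pose D := \bigcup_(p in F) pp_dom p.
have dir p q : F p -> F q -> exists r, [/\ F r, pp_le p r & pp_le q r].
  by move=> Fp Fq; have [pq|qp] := Ftot _ _ Fp Fq; [exists q|exists p];
    split=> //; exact: pp_le_refl.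
have /choice[g gP] (u : T * T) : exists z, forall p, F p -> pp_dom p u.1 ->
    pp_dom p u.2 -> z = pp_fun p u.1 u.2.
  have [[p [Fp pu1 pu2]]|no] :=
      pselect (exists p, [/\ F p, pp_dom p u.1 & pp_dom p u.2]).
    exists (pp_fun p u.1 u.2) => q Fq q1 q2.
    have [r [_ /asboolP[_ pr] /asboolP[_ qr]]] := dir _ _ Fp Fq.
    by rewrite pr // qr.
  by exists a => p Fp pu1 pu2; case: no; exists p.
have D2 x y : D x -> D y -> exists p, [/\ F p, pp_dom p x & pp_dom p y].
  move=> [p Fp px] [q Fq qy].
  have [r [Fr /asboolP[pr _] /asboolP[qr _]]] := dir _ _ Fp Fq.
  by exists r; split=> //; [exact: pr|exact: qr].
pose f x y := g (x, y).
have Da : D a by exists p1 => //; exact: pp_a.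
have Db : D b by exists p1 => //; exact: pp_b.
have fD x y : D x -> D y -> D (f x y).
  move=> Dx Dy; have [p [Fp px py]] := D2 x y Dx Dy.
  by exists p => //; rewrite /f (gP _ p) //; exact: pp_closed.
have finj x y x' y' : f x y = f x' y' -> D x -> D y -> D x' -> D y' ->
    x = x' /\ y = y'.
  move=> + /D2 Dx /Dx[p [Fp px py]] /D2 Dx' /Dx'[q [Fq qx qy]].
  have [r [Fr /asboolP[pr _] /asboolP[qr _]]] := dir _ _ Fp Fq.
  have [[rx ry] [rx' ry']] := ((pr _ px, pr _ py), (qr _ qx, qr _ qy)).
  by rewrite /f !(gP _ r) // => e; exact: (pp_inj e).
exists (PartialPairing Da Db fD finj) => p Fp.
apply/asboolP; split=> /= [x px|x y px py]; first by exists p.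
by rewrite /f (gP _ p).
Qed.

(** Starting point for Zorn's lemma: a copy of the natural numbers inside [T], paired by
    [pickle]. *)
Lemma pp_nat (T : Type) : infinite_set [set: T] ->
  exists a b : T, a <> b /\ inhabited (partial_pairing a b).
Proof.
move=> Tinf; have [t0 _] := infinite_setN0 Tinf.
have [e _ einj] := card_le_fun t0 ((infiniteP _).1 Tinf).
have {}einj m n : e m = e n -> m = n by exact: einj.
have /choice[e' e'K] x : exists n, forall m, x = e m -> n = m.
  have [[n ->]|no] := pselect (exists n, x = e n); first by exists n => m /einj.
  by exists 0%N => m xm; case: no; exists m.
have eK n : e' (e n) = n by exact: e'K.
exists (e 0%N), (e 1%N); split; first by move/einj.
constructor; apply: (@PartialPairing _ _ _ (range e)
  (fun x y => e (pickle (e' x, e' y)))) => [||x y|x y x' y'].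
- by exists 0%N.
- by exists 1%N.
- by exists (pickle (e' x, e' y)).
- move=> + [m _ xm] [n _ yn] [m' _ xm'] [n' _ yn']; subst x y x' y'.
  by rewrite !eK => /einj/(pcan_inj pickleK)[-> ->].
Qed.

(** Tag [a] marks a point of [D], tag [b] a point outside [D] that [g] has moved into [D]. The tags
    differ, so the two sorts of codes never collide. *)
Lemma pp_merge (T : Type) (a b : T) (ab : a <> b) (p : partial_pairing a b)
    (D := pp_dom p) (E : set T) (g : T -> T) :
    (forall x, E x -> ~ D x -> D (g x)) ->
    (forall x y, E x -> E y -> ~ D x -> ~ D y -> g x = g y -> x = y) ->
  exists2 c : T -> T, (forall x, E x -> D (c x)) &
    (forall x y, E x -> E y -> c x = c y -> x = y).
Proof.
move=> gD ginj.
have [Da Db] := (pp_a p, pp_b p).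
exists (fun x => if `[< D x >] then pp_fun p a x else pp_fun p b (g x)).
  move=> x Ex; case: asboolP => Dx; first exact: pp_closed.
  by apply: pp_closed => //; exact: gD.
move=> x y Ex Ey; case: asboolP => Dx; case: asboolP => Dy.
- by move=> e; case: (pp_inj e Da Dx Da Dy).
- by move=> e; case: (pp_inj e Da Dx Db (gD _ Ey Dy)).
- by move=> e; case: (pp_inj e Db (gD _ Ex Dx) Da Dy) => /esym.
- move=> e; case: (pp_inj e Db (gD _ Ex Dx) Db (gD _ Ey Dy)) => _.
  exact: ginj.
Qed.

(* Zorn's lemma gives a maximal injection [D * D -> D].  If [~` D] embeds into
   [D], then the whole type does.  Otherwise [D] embeds into [~` D] by some [g],
   and with [E := D `|` g @` D] the pairs in [E * E] outside [D * D] can be sent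
   injectively into [g @` D], contradicting maximality. *)
Lemma infinite_pairing (T : Type) : infinite_set [set: T] ->
  exists f : T -> T -> T, forall x y x' y', f x y = f x' y' -> x = x' /\ y = y'.
Proof.
move=> /pp_nat[a [b [ab [p0]]]].
have [|||p pmax] := @ZL_preorder _ p0 (@pp_le T a b).
- exact: pp_le_refl.
- move=> q p r /asboolP[pq fpq] /asboolP[qr fqr]; apply/asboolP.
  split=> [x /pq/qr//|x y px py]; rewrite fpq // fqr //; exact: pq.
- exact: pp_chain_bounded.
set D := pp_dom p in pmax *.
have [Da Db] : D a /\ D b by split; [exact: pp_a|exact: pp_b].
have [|] := card_le_total (~` D) D => le;
  have [g gD ginj] := card_le_fun a le.
  have [||c cD cinj] := @pp_merge _ _ _ ab p setT g.
  - by move=> x _; exact: gD.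
  - by move=> x y _ _; exact: ginj.
  exists (fun x y => pp_fun p (c x) (c y)) => x y x' y'.
  have {}cD z : D (c z) by exact: cD.
  move=> e; case: (pp_inj e (cD _) (cD _) (cD _) (cD _)).
  by move=> /cinj-> // /cinj->.
have /choice[g' g'P] x : exists y, forall z, D z -> x = g z -> y = z.
  have [[y Dy ->]|no] := pselect (exists2 y, D y & x = g y).
    by exists y => z Dz; exact: ginj.
  by exists x => z Dz xz; case: no; exists z.
have g'K x : D x -> g' (g x) = x by move=> Dx; exact: g'P.
pose E := D `|` g @` D.
(* [g'] undoes [g] on the image of [D], so [E] is compressed into [D] by [c]. Pairing after [c] and
   then applying [g] gives values off [D], which cannot clash with the old ones. *)
have [||c cD cinj] := @pp_merge _ _ _ ab p E g'.
- by move=> x [//|[y Dy <-]] _; rewrite g'K.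
- move=> x y [//|[x' Dx' <-]] [//|[y' Dy' <-]] _ _.
  by rewrite !g'K // => ->.
pose f x y := if `[< D x /\ D y >] then pp_fun p x y
              else g (pp_fun p (c x) (c y)).
have fE x y : E x -> E y -> E (f x y).
  move=> Ex Ey; rewrite /f; case: asboolP => [[Dx Dy]|_].
    by left; exact: pp_closed.
  by right; exists (pp_fun p (c x) (c y)) => //; apply: pp_closed; exact: cD.
have pcD x y : E x -> E y -> D (pp_fun p (c x) (c y)).
  by move=> Ex Ey; apply: pp_closed; exact: cD.
have finj x y x' y' : f x y = f x' y' -> E x -> E y -> E x' -> E y' ->
    x = x' /\ y = y'.
  move=> + Ex Ey Ex' Ey'; rewrite /f.
  case: asboolP => [[Dx Dy]|_]; case: asboolP => [[Dx' Dy']|_].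
  - by move=> e; exact: (pp_inj e).
  - move=> e; case: (gD _ (pcD _ _ Ex' Ey')); rewrite -e; exact: pp_closed.
  - move=> e; case: (gD _ (pcD _ _ Ex Ey)); rewrite e; exact: pp_closed.
  - move=> /(ginj _ _ (pcD _ _ Ex Ey) (pcD _ _ Ex' Ey')) e.
    case: (pp_inj e (cD _ Ex) (cD _ Ey) (cD _ Ex') (cD _ Ey')).
    by move=> /cinj-> // /cinj->.
have [Ea Eb] : E a /\ E b by split; left.
have /pmax/asboolP[/= ED _] : pp_le p (PartialPairing Ea Eb fE finj).
  apply/asboolP; split=> /= [x|x y Dx Dy]; first by left.
  by rewrite /f; case: asboolP => // -[].
by case: (gD a Da); apply: ED; right; exists a.
Qed.

(** * Counting words over [bool] *)

(** A recursive code: [f] packs a constructor tag [e 0], [e 1] or [e 2] with the code of the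
    arguments into one point of [T]. *)
Lemma card_le_word (T J : Type) (iJ : J -> T) :
    infinite_set [set: T] -> injective iJ ->
  exists i : word bool J -> T, injective i.
Proof.
move=> Tinf iJinj; have [f finj] := infinite_pairing Tinf.
have [t0 _] := infinite_setN0 Tinf.
have [e _ einj] := card_le_fun t0 ((infiniteP _).1 Tinf).
have {}einj m n : e m = e n -> m = n by exact: einj.
pose fix i (w : word bool J) := match w with
  | WVar j => f (e 0%N) (iJ j)
  | WConst c => f (e 1%N) (e (nat_of_bool c))
  | WMeet v w => f (e 2%N) (f (i v) (i w)) end.
exists i; elim=> [j|c|v IHv w IHw] [j'|c'|v' w'] /= /finj[/einj]//.
- by move=> _ /iJinj->.
- by move=> _ /einj; case: c c' => -[].
- by move=> _ /finj[/IHv-> /IHw->].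
Qed.

(** * Jumps in a chain of intersections *)

(** Each member of [L] is the intersection of the [B i] containing it, so a jump [(S, S')] has an
    [i] with [S] but not [S'] inside [B i]. If [(T1, T2)] shares this [i], then [S'] is not inside
    [T1], which forces [T1] inside [S]. By symmetry [S = T1], and the lower end determines the
    jump. *)
Lemma card_jumps_le (T I : Type) (B : I -> set T) (L : set (set T)) :
    (forall S a, L S -> (forall i, S `<=` B i -> B i a) -> S a) ->
  forall C, chain_in L C -> jumps C #<= [set: I].
Proof.
move=> LB C [CL Ctot].
apply: (@card_le_rel _ _ (fun p i => p.1 `<=` B i /\ ~ p.2 `<=` B i)).
  move=> [S S'] [/= CS CS' /properPset[SS' S'S] _].
  apply: contrapT => none; apply: S'S => a S'a.
  apply: (LB _ _ (CL _ CS)) => i SB; apply: contrapT => Bia.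
  by apply: none; exists i => //; split=> // /(_ a S'a).
have jump_cases S S' X : jumps C (S, S') -> C X -> X `<=` S \/ S' `<=` X.
  move=> [/= CS CS' _ noX] CX.
  have [/subsetPset XS|/subsetPset SX] := Ctot _ _ CX CS; first by left.
  have [/subsetPset XS'|/subsetPset S'X] := Ctot _ _ CX CS'; last by right.
  have [XS|nXS] := pselect (X `<=` S); first by left.
  have [S'X|nS'X] := pselect (S' `<=` X); first by right.
  by case: noX; exists X => //; apply/andP; split; apply/properPset.
have lower S S' T1 T2 i : jumps C (S, S') -> jumps C (T1, T2) ->
    ~ S' `<=` B i -> T1 `<=` B i -> T1 `<=` S.
  move=> jS [/= CT1 _ _ _] S'B T1B.
  have [//|S'T1] := jump_cases S S' T1 jS CT1.
  by case: S'B; exact: subset_trans T1B.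
have upper S S' T2 : jumps C (S, S') -> jumps C (S, T2) -> S' `<=` T2.
  move=> jS [/= _ CT2 /properPset[_ T2S] _].
  by have [|//] := jump_cases S S' T2 jS CT2.
move=> [S S'] [T1 T2] i jS jT [/= SB S'B] [/= T1B T2B].
have eST : S = T1.
  apply/seteqP; split; first exact: (lower T1 T2 S S' i).
  exact: (lower S S' T1 T2 i).
subst T1; congr pair.
by apply/seteqP; split; [exact: (upper S)|exact: (upper S)].
Qed.

(** * Solution sets over equivalence relations *)

Fixpoint word_map (A B J : Type) (h : A -> B) (w : word A J) : word B J :=
  match w with
  | WVar j => WVar B j
  | WConst c => WConst J (h c)
  | WMeet v w => WMeet (word_map h v) (word_map h w)
  end.

Lemma word_eval_map (d d' : Order.disp_t) (A : meetSemilatticeType d)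
    (B : meetSemilatticeType d') (J : Type) (h : A -> B) (w : word A J)
    (a : J -> A) :
    {morph h : x y / Order.meet x y >-> Order.meet x y} ->
  h (word_eval w a) = word_eval (word_map h w) (h \o a).
Proof. by move=> hI; elim: w => //= v IHv w IHw; rewrite hI IHv IHw. Qed.

Lemma card_jumps_solution_lattice (Omega J : Type) (d : Order.disp_t)
    (A : meetSemilatticeType d) (C : set (set (J -> A))) :
    infinite_set [set: Omega] -> [set: J] #<= [set: Omega] ->
    meet_embeddable A (Equiv Omega) -> chain_in (solution_lattice A J) C ->
  jumps C #<= [set: Omega].
Proof.
move=> Oinf JO [f finj fI]; have [o _] := infinite_setN0 Oinf.
have [iJ _ iJinj] := card_le_fun o JO.
have {}iJinj : injective iJ by move=> x y; exact: iJinj.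
have [e enc_inj] := card_le_word Oinf iJinj.
have [g ginj] := infinite_pairing Oinf.
(* Each [r x y] is a meet morphism to [bool], and together they separate the points of [A]. *)
pose r x y (c : A) : bool := equiv (f c) x y.
pose B (i : word bool J * word bool J * (Omega * Omega)) : set (J -> A) :=
  [set a | word_eval i.1.1 (r i.2.1 i.2.2 \o a) =
           word_eval i.1.2 (r i.2.1 i.2.2 \o a)].
have rI x y : {morph r x y : u v / Order.meet u v >-> Order.meet u v}.
  by move=> u v; rewrite /r fI.
have LB S a : solution_lattice A J S -> (forall i, S `<=` B i -> B i a) -> S a.
  move=> [F FP ->] SBa P FPP; have [v [w Pvw]] := FP _ FPP; subst P.
  apply/finj/Equiv_ext => x y.
  change (r x y (word_eval v a) = r x y (word_eval w a)).
  rewrite !(word_eval_map _ _ (rI x y)).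
  (* The image of the equation under [r x y] holds on all of [S], so its solution set is a [B i]
     containing [S]. *)
  apply: (SBa (word_map (r x y) v, word_map (r x y) w, (x, y))) => a' Sa'.
  have /(congr1 (r x y)) : word_eval v a' = word_eval w a' := Sa' _ FPP.
  by rewrite !(word_eval_map _ _ (rI x y)).
move=> CL; apply: card_le_trans (card_jumps_le LB CL) _.
apply: (@card_le_injective _ _
    (fun i => g (g (e i.1.1) (e i.1.2)) (g i.2.1 i.2.2))) => //.
move=> [[v w] [x y]] [[v' w'] [x' y']] _ _ /= /ginj[].
by move=> /ginj[/enc_inj-> /enc_inj->] /ginj[-> ->].
Qed.

Theorem theorem6p1 (Omega J : Type)
    (Omega_infinite : infinite_set [set: Omega])
    (card_J : [set: J] #<= [set: Omega]) :
  [/\ ~ (exists2 C : set (set (J -> Equiv Omega)),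
           chain_in (solution_lattice (Equiv Omega) J) C &
           card_lt [set: Omega] (jumps C)),
      (forall (d : Order.disp_t) (A : meetSemilatticeType d),
         meet_embeddable A (Equiv Omega) ->
         ~ (exists2 C : set (set (J -> A)),
              chain_in (solution_lattice A J) C &
              card_lt [set: Omega] (jumps C))) &
      (forall (d : Order.disp_t) (A : latticeType d),
         lattice_embeddable A (Equiv Omega) ->
         ~ (exists2 C : set (set (J -> A)),
              chain_in (solution_lattice A J) C &
              card_lt [set: Omega] (jumps C)))].
Proof.
(* All three parts are one bound: the identity embeds [Equiv Omega] into itself, and a lattice
   embedding preserves meets. *)
split=> [[C CL [_]]|d A emb [C CL [_]]|d A [f [finj fI _]] [C CL [_]]]; apply.
- by apply: (card_jumps_solution_lattice Omega_infinite card_J _ CL); exists id.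
- exact: (card_jumps_solution_lattice Omega_infinite card_J emb CL).
- by apply: (card_jumps_solution_lattice Omega_infinite card_J _ CL); exists f.
Qed.
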